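(* Let $\mathcal{H}$ be a Hilbert space, let $F:\mathcal{H}\to\mathbb{R}$ be a functional, let $\mathcal{V}\subseteq\mathcal{H}$ be a (not necessarily closed) subspace, let $h\in\mathcal{H}$, and let $\mathcal{W}:=h+\mathcal{V}$ be the corresponding affine space. Assume that $F$ is Gâteaux-differentiable at $w_c\in\mathcal{W}$ in every direction $v\in\mathcal{V}$ and that the Gâteaux differential is given by the linear, continuous map $$F'(w_c;v)=\langle D_{\mathcal{V}}F(w_c),v\rangle_{\mathcal{H}},\qquad v\in\mathcal{V},$$ where $D_{\mathcal{V}}F(w_c)\in\mathcal{H}$. Then $w_c$ is a critical point of $F$ over $\mathcal{W}$ if and only if $D_{\mathcal{V}}F(w_c)\in\mathcal{V}^\perp$. When $F$ is actually Fréchet differentiable at $w_c\in\mathcal{W}$, $w_c$ is a critical point of $F$ over $\mathcal{W}$ if and only if $DF(w_c)\in\mathcal{V}^\perp$.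
   Context: $F$ is Gâteaux-differentiable at $h_0$ in direction $v$ if the limit $F'(h_0;v):=\lim_{\epsilon\to 0}\frac{F(h_0+\epsilon v)-F(h_0)}{\epsilon}$ ($\epsilon$ real) exists. $F$ is Fréchet-differentiable at $h_0$ if there is an element $DF(h_0)\in\mathcal{H}$ (the Fréchet differential) such that $\lim_{\|h\|_{\mathcal{H}}\to 0}\frac{|F(h_0+h)-F(h_0)-\langle DF(h_0),h\rangle_{\mathcal{H}}|}{\|h\|_{\mathcal{H}}}=0$. A point $w_c\in\mathcal{W}=h+\mathcal{V}$ is a critical point of $F$ over $\mathcal{W}$ if $F'(w_c;v)=0$ for all $v\in\mathcal{V}$. $\mathcal{V}^\perp$ is the orthogonal complement of $\mathcal{V}$, i.e. the set of $u\in\mathcal{H}$ with $\langle u,v\rangle_{\mathcal{H}}=0$ for all $v\in\mathcal{V}$. *)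

(* Defs.v *)
From HB Require Import structures.
From mathcomp Require Import all_boot all_order all_algebra sesquilinear.
From mathcomp Require Import complex.
From mathcomp Require Import all_classical all_reals topology normedtype.

Set Implicit Arguments.
Unset Strict Implicit.
Unset Printing Implicit Defensive.

Import Order.TTheory GRing.Theory Num.Theory.
Import numFieldNormedType.Exports.

Local Open Scope classical_set_scope.
Local Open Scope ring_scope.

(* The scalar field of a Hilbert space: either R itself or C = R[i].
   In both cases functionals are R-valued and difference quotients are taken
   along real increments, hence the embedding of R into the scalars. *)
Variant scalar_kind := RealScalars | ComplexScalars.

Definition scalar_field (R : realType) (k : scalar_kind) : numFieldType :=
  match k with
  | RealScalars => R
  | ComplexScalars => R[i]
  end.

Definition of_real (R : realType) (k : scalar_kind) : R -> scalar_field R k :=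
  match k with
  | RealScalars => fun x => x
  | ComplexScalars => fun x => real_complex R x
  end.

Definition scalar_conj (R : realType) (k : scalar_kind) :
    scalar_field R k -> scalar_field R k :=
  match k with
  | RealScalars => idfun
  | ComplexScalars => @conjc R
  end.

Section HilbertFunctionals.
Variables (R : realType) (k : scalar_kind).
Variable H : completeNormedModType (scalar_field R k).
Variable dot : {dot H for @scalar_conj R k}.

(* Convention: dot is linear in its first argument and conjugate-linear in the
   second.  Over C, the real number F'(w; v) is compared with dot D v through
   of_real. *)

(* Completeness is carried by H, positive definiteness by dot: this equation
   is what makes the complete normed space (H, dot) a Hilbert space. *)
Definition norm_induced_by : Prop := forall u : H, `|u| ^+ 2 = dot u u.

Definition affine_space (h : H) (V : set H) : set H := [set h + v | v in V].

Definition orthogonal_complement (V : set H) : set H :=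
  [set u | forall v, V v -> dot u v = 0].

Definition gateaux_quotient (F : H -> R) (h0 v : H) (e : R) : R :=
  (F (h0 + of_real k e *: v) - F h0) / e.

Definition gateaux_differentiable (F : H -> R) (h0 v : H) : Prop :=
  cvg (gateaux_quotient F h0 v e @[e --> 0^']).

(* Meaningful only under gateaux_differentiable, lim being total. *)
Definition gateaux_derivative (F : H -> R) (h0 v : H) : R :=
  lim (gateaux_quotient F h0 v e @[e --> 0^']).

Definition is_frechet_differential (F : H -> R) (h0 D : H) : Prop :=
  `|of_real k (F (h0 + h) - F h0) - dot D h| / `|h| @[h --> (0 : H)^']
    --> (0 : scalar_field R k).

Definition critical_point (F : H -> R) (h : H) (V : set H) (wc : H) : Prop :=
  affine_space h V wc /\
  forall v, V v ->
    gateaux_differentiable F wc v /\ gateaux_derivative F wc v = 0.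

End HilbertFunctionals.

(* Main.v *)
(* At the increment [e v], with [e] real and [v != 0], the Frechet remainder
   divided by the norm is [|q e - <D, v>| / |v|], where [q] is the Gateaux
   quotient.  Hence the Gateaux derivative along [v] is [<D, v>], and it vanishes
   for every [v] in [V] exactly when [D] is orthogonal to [V]. *)
Require Import Defs.
From HB Require Import structures.
From mathcomp Require Import all_boot all_order all_algebra sesquilinear.
From mathcomp Require Import complex.
From mathcomp Require Import all_classical all_reals topology normedtype.

Import Order.TTheory GRing.Theory Num.Theory.
Import numFieldNormedType.Exports.

Local Open Scope classical_set_scope.
Local Open Scope ring_scope.

Section ScalarEmbedding.
Set Implicit Arguments.
Unset Strict Implicit.
Variables (R : realType) (k : scalar_kind).

Lemma of_realB (x y : R) : of_real k (x - y) = of_real k x - of_real k y.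
Proof. by case: k => //=; rewrite rmorphB. Qed.

Lemma of_realM (x y : R) : of_real k (x * y) = of_real k x * of_real k y.
Proof. by case: k => //=; rewrite rmorphM. Qed.

Lemma of_realV (x : R) : of_real k x^-1 = (of_real k x)^-1.
Proof. by case: k => //=; rewrite fmorphV. Qed.

Lemma of_real0 : of_real k 0 = 0 :> scalar_field R k.
Proof. by case: k. Qed.

Lemma of_real_inj : injective (of_real k : R -> scalar_field R k).
Proof. by case: k => x y //= -[]. Qed.

Lemma ltr_of_real (x y : R) : (of_real k x < of_real k y) = (x < y).
Proof. by case: k => //=; rewrite ltcR. Qed.

Lemma norm_of_real (x : R) : `|of_real k x| = of_real k `|x|.
Proof. by case: k => //=; rewrite normc_def /= expr0n addr0 sqrtr_sqr. Qed.

Lemma scalar_conj_of_real (x : R) :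
  scalar_conj (of_real k x) = of_real k x.
Proof. by case: k => //; exact: conjc_real. Qed.

(** The order on [R[i]] compares only numbers with equal imaginary parts, so a positive scalar is
    real. *)
Lemma gt0_of_real (x : scalar_field R k) :
  0 < x -> exists2 r : R, 0 < r & x = of_real k r.
Proof.
case: k x => [x x0|[a b]] /=; first by exists x.
by rewrite ltcE /= => /andP[/eqP -> a0]; exists a.
Qed.

(** [of_real] is isometric, and by [gt0_of_real] the radii allowed in the scalar field are exactly
    the real ones. *)
Lemma cvg_of_real T (G : set_system T) {FG : Filter G} (f : T -> R) (a : R) :
  of_real k (f x) @[x --> G] --> of_real k a <-> f x @[x --> G] --> a.
Proof.
split=> /cvgrPdist_lt fa; apply/cvgrPdist_lt => e e0.
  have := fa (of_real k e); rewrite -[X in X < _]of_real0 ltr_of_real => /(_ e0).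
  by apply: filterS => t; rewrite -of_realB norm_of_real ltr_of_real.
have [r r0 ->] := gt0_of_real e0.
apply: filterS (fa r r0) => t.
by rewrite -of_realB norm_of_real ltr_of_real.
Qed.

End ScalarEmbedding.

Section FrechetGateaux.
Set Implicit Arguments.
Unset Strict Implicit.
Variables (R : realType) (k : scalar_kind).
Variable H : completeNormedModType (scalar_field R k).
Variable dot : {dot H for @scalar_conj R k}.
Implicit Types (F : H -> R) (v D : H).

Lemma dotZr_of_real D v (e : R) :
  dot D (of_real k e *: v) = of_real k e * dot D v.
Proof. by rewrite linearr_subproof /= scalar_conj_of_real. Qed.

(** Continuity of the line gives the limit; its injectivity keeps nonzero parameters away from the
    origin, as the punctured filter requires. *)
Lemma cvg_line_dnbhs0 v : v != 0 ->
  of_real k e *: v @[e --> (0 : R)^'] --> (0 : H)^'.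
Proof.
move=> v0.
have -> : (0 : H) = of_real k (0 : R) *: v by rewrite of_real0 scale0r.
apply: (@continuous_injective_withinNx _ _ (fun e : R => of_real k e *: v)) => [|e].
  by apply: cvgZr_tmp; apply/cvg_of_real; exact: cvg_id.
move=> /eqP; rewrite -subr_eq0 -scalerBl scaler_eq0 (negPf v0) orbF subr_eq0.
by move=> /eqP /of_real_inj.
Qed.

(* The limit is stated in the scalar field because [dot D v] is not known
   beforehand to be real when [k = ComplexScalars]. *)
Lemma frechet_gateaux_quotient_cvg F h0 D :
  is_frechet_differential dot F h0 D -> forall v,
  of_real k (gateaux_quotient F h0 v e) @[e --> 0^'] --> dot D v.
Proof.
move=> FD v; have [->|v0] := eqVneq v 0.
  (* For [v = 0] the line never leaves the origin, so the Frechet limit says nothing; the quotient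
     is identically zero instead. *)
  have -> : dot D 0 = 0 by rewrite linear0r.
  rewrite -(of_real0 R k); apply/cvg_of_real.
  rewrite (_ : gateaux_quotient _ _ _ = cst 0); first exact: cvg_cst.
  by apply/funext => e; rewrite /gateaux_quotient scaler0 addr0 subrr mul0r.
apply/cvgrPdist_lt => e e0.
have nv0 : 0 < `|v| by rewrite normr_gt0.
have {FD} := cvg_comp _ _ (cvg_line_dnbhs0 v0) FD.
(* The tolerance [e / |v|] absorbs the factor [|v|] of the norm of the increment [t v]. *)
move=> /cvgrPdist_lt /(_ (e / `|v|)); rewrite divr_gt0// => /(_ isT) FD.
near=> t.
have t0 : t != 0 by near: t; exact: nbhs_dnbhs_neq.
have rt0 : of_real k t != 0.
  by rewrite -(of_real0 R) (inj_eq (@of_real_inj R k)).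
have : `|0 - `|of_real k (F (h0 + of_real k t *: v) - F h0)
    - dot D (of_real k t *: v)| / `|of_real k t *: v| | < e / `|v|.
  by near: t; exact: FD.
(* After [|v|] cancels, [1 / |t|] moves inside the norm, turning the increment of [F] into the
   quotient and [dot D (t v)] into [dot D v]. *)
rewrite sub0r normrN normrM normfV !normr_id normrZ dotZr_of_real invfM mulrA.
rewrite ltr_pM2r ?invr_gt0// -normfV -normrM mulrBl mulrAC mulfV// mul1r.
by rewrite -of_realV -of_realM distrC.
Unshelve. all: by end_near. Qed.

End FrechetGateaux.

Theorem theorem3p3 (R : realType) (k : scalar_kind)
    (H : completeNormedModType (scalar_field R k))
    (dot : {dot H for @scalar_conj R k})
    (H_hilbert : norm_induced_by dot)
    (F : H -> R) (V : set H) (V_subspace : submod_closed [in V])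
    (h wc : H) (wc_in_W : affine_space h V wc) :
  (forall DV : H,
     (forall v, V v -> gateaux_differentiable F wc v) ->
     (forall v, V v -> of_real k (gateaux_derivative F wc v) = dot DV v) ->
     (critical_point F h V wc <-> orthogonal_complement dot V DV))
  /\
  (forall DF : H,
     is_frechet_differential dot F wc DF ->
     (critical_point F h V wc <-> orthogonal_complement dot V DF)).
Proof.
split=> [DV Fdiff FDV|DF FDF]; (split=> [[_ crit] v Vv|ortho]; last split=> // v Vv).
- by have [_ F'0] := crit _ Vv; rewrite -FDV// F'0 of_real0.
- split; first exact: Fdiff.
  by apply: (@of_real_inj R k); rewrite FDV// ortho// of_real0.
- have [Fv F'0] := crit _ Vv.
  (* Differentiability makes the value 0 of [lim] a genuine limit, to be compared with [dot DF v] by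
     uniqueness in the scalar field. *)
  have {F'0} /(@cvg_of_real R k) : gateaux_quotient F wc v e @[e --> 0^'] --> (0 : R).
    by rewrite -[X in _ --> X]F'0; exact: Fv.
  rewrite of_real0 => q0.
  exact: (norm_cvg_unique (frechet_gateaux_quotient_cvg FDF (v := v)) q0).
- have := frechet_gateaux_quotient_cvg FDF (v := v).
  (* Orthogonality makes the scalar limit 0, which is real, so the convergence descends to [R]. *)
  rewrite ortho// -(of_real0 R k) => /cvg_of_real q0.
  by split; [exact: cvgP q0 | exact: cvg_lim q0].
Qed.
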